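(* Let ${\mathbf A}=\{a_{ij}\}_{i,j=1}^n$ and ${\mathbf B}=\{b_{ij}\}_{i,j=1}^n$ be real $n\times n$ matrices, both upper triangular (or both lower triangular), let $\alpha\in{\mathbb R}$, and let $$\widetilde{\mathbf A}=\begin{pmatrix}{\mathbf A}&{\mathbf B}\\ {\mathbf I}&{\mathbf O}\end{pmatrix}$$ be the corresponding $2n\times 2n$ matrix. Then $\widetilde{\mathbf A}$ is ${\mathbb C}^-_\alpha$-stable if and only if $\frac{a_{ii}}{2}<\alpha$ and $b_{ii}<\alpha^2-\alpha a_{ii}$ for all $i=1,\ldots,n$.
   Context: ${\mathbf I}$, ${\mathbf O}$ are the $n\times n$ identity and zero matrices. ${\mathbb C}^-_\alpha=\{\lambda\in{\mathbb C}:{\rm Re}(\lambda)<\alpha\}$; a matrix is ${\mathbb C}^-_\alpha$-stable if all its eigenvalues lie in ${\mathbb C}^-_\alpha$. *)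

(* Defs.v *)
From HB Require Import structures.
From mathcomp Require Import all_boot all_order all_algebra.
From mathcomp Require Import complex reals.

Set Implicit Arguments.
Unset Strict Implicit.
Unset Printing Implicit Defensive.

Import Order.TTheory GRing.Theory Num.Theory.
Local Open Scope ring_scope.

Definition lower_triangular (R : realType) (n : nat) (A : 'M[R]_n) : bool :=
  is_trig_mx A.

(* MathComp's [is_trig_mx] is lower triangularity, hence the transpose. *)
Definition upper_triangular (R : realType) (n : nat) (A : 'M[R]_n) : bool :=
  is_trig_mx A^T.

Definition Cminus (R : realType) (alpha : R) : pred R[i] :=
  [pred lambda : R[i] | complex.Re lambda < alpha].

(* [eigenvalue] only sees eigenvalues in the base field of the matrix, so a
   real matrix is first embedded into the complex matrices.  [eigenvalue] is
   defined through row eigenvectors, which give the same eigenvalues as column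
   eigenvectors. *)
Definition Cminus_stable (R : realType) (alpha : R) (m : nat) (M : 'M[R]_m) :
    Prop :=
  forall lambda : R[i],
    eigenvalue (map_mx (real_complex R) M) lambda -> lambda \in Cminus alpha.

Definition companion_block (R : realType) (n : nat) (A B : 'M[R]_n) :
    'M[R]_(n + n) :=
  block_mx A B 1%:M 0.

(* Main.v *)
Require Import Defs.
From HB Require Import structures.
From mathcomp Require Import all_boot all_order all_algebra.
From mathcomp Require Import complex reals.
From mathcomp Require Import ring lra.

Set Implicit Arguments.
Unset Strict Implicit.
Unset Printing Implicit Defensive.

Import Order.TTheory GRing.Theory Num.Theory.
Local Open Scope ring_scope.

(** The block matrix is a linearization of the quadratic matrix pencil
    [z^2 I - z A - B]: a left eigenvector for [z] has the form
    [(u, z u - u A)] with [u] a nonzero vector in the left kernel of the pencil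
    at [z] ([eigenvalue_block_companion]).  When [A] and [B] are triangular on
    the same side, so is the pencil, and its determinant is the product of the
    scalar quadratics [z^2 - a_ii z - b_ii]; the spectrum of the block matrix is
    thus the union of the root sets of these quadratics
    ([eigenvalue_companion_block_triangular]).  It remains to see when both
    roots of one real quadratic [z^2 - a z - b] lie to the left of [alpha]
    ([quadratic_roots_Re_lt]).  The mean of the real parts of the roots is
    [a / 2], and the value of the quadratic at [alpha] must be positive, since
    [alpha] lies to the right of every real root; conversely the
    quadratic increases on the right of [a / 2], so positivity at [alpha] leaves
    no real root beyond, while nonreal roots have real part exactly [a / 2]. *)

(** * Spectrum of the block companion matrix *)

(** The left half of the eigenvector equation for [(u, v)] expresses [v]
    through [u], and substituting turns the right half into the pencil
    equation for [u]. *)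
Lemma eigenvalue_block_companion (F : fieldType) (n : nat) (A B : 'M[F]_n)
    (z : F) :
  eigenvalue (block_mx A B 1%:M 0) z =
  (\det ((z ^+ 2)%:M - z *: A - B) == 0).
Proof.
have pencilE (u : 'rV_n) : u *m ((z ^+ 2)%:M - z *: A - B) =
    z *: (z *: u - u *m A) - u *m B.
  by rewrite !mulmxBr mul_mx_scalar -scalemxAr scalerBr scalerA expr2.
apply/eigenvalueP/det0P => [[w] | [u u_neq0]].
  rewrite -[w]hsubmxK; set u := lsubmx w; set v := rsubmx w.
  rewrite mul_row_block mulmx1 mulmx0 addr0 scale_row_mx.
  move=> /eq_row_mx[uAv uB] uv_neq0.
  have vE : v = z *: u - u *m A by rewrite -uAv addrC addKr.
  exists u; last by rewrite pencilE -vE uB subrr.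
  apply: contra_neq uv_neq0 => u0.
  by rewrite vE u0 scaler0 mul0mx subrr row_mx0.
rewrite pencilE => /subr0_eq uB.
exists (row_mx u (z *: u - u *m A)).
  by rewrite mul_row_block mulmx1 mulmx0 addr0 scale_row_mx uB addrC subrK.
apply: contra_neq u_neq0 => uv0.
by have [] := eq_row_mx (etrans uv0 (esym (row_mx0 _ _ _ _))).
Qed.

Lemma det_pencil_trig (F : comNzRingType) (n : nat) (A B : 'M[F]_n) (z : F) :
  is_trig_mx A -> is_trig_mx B ->
  \det ((z ^+ 2)%:M - z *: A - B) =
  \prod_i (z ^+ 2 - z * A i i - B i i).
Proof.
move=> /is_trig_mxP trigA /is_trig_mxP trigB.
rewrite det_trig; first by apply: eq_bigr => i _; rewrite !mxE eqxx mulr1n.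
apply/is_trig_mxP => i j lt_ij; rewrite !mxE trigA // trigB //.
by rewrite -val_eqE ltn_eqF // mulr0n mulr0 !subr0.
Qed.

Lemma map_mx_trig (U V : nmodType) (f : {additive U -> V}) (m n : nat)
    (A : 'M[U]_(m, n)) :
  is_trig_mx A -> is_trig_mx (map_mx f A).
Proof.
move=> /is_trig_mxP trigA; apply/is_trig_mxP => i j lt_ij.
by rewrite mxE trigA // raddf0.
Qed.

Lemma eigenvalue_companion_block_triangular (R : realType) (n : nat)
    (A B : 'M[R]_n) (z : R[i]) :
  (upper_triangular A /\ upper_triangular B) \/
  (lower_triangular A /\ lower_triangular B) ->
  reflect (exists i, z ^+ 2 - z * (A i i)%:C%C - (B i i)%:C%C = 0)
    (eigenvalue (map_mx (real_complex R) (companion_block A B)) z).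
Proof.
move=> trigAB.
rewrite /companion_block map_block_mx map_mx1 map_mx0.
rewrite eigenvalue_block_companion.
set A' := map_mx _ A; set B' := map_mx _ B.
suff -> : \det ((z ^+ 2)%:M - z *: A' - B') =
    \prod_i (z ^+ 2 - z * (A i i)%:C%C - (B i i)%:C%C).
  apply: (iffP (prodf_eq0 _ _)) => [[i _ /eqP zi0] | [i zi0]]; first by exists i.
  by exists i => //; apply/eqP.
case: trigAB => -[trigA trigB].
  rewrite -det_tr !linearB /= linearZ /= tr_scalar_mx det_pencil_trig.
  - by apply: eq_bigr => i _; rewrite !mxE.
  - by rewrite map_trmx; exact: map_mx_trig.
  - by rewrite map_trmx; exact: map_mx_trig.
rewrite det_pencil_trig; [|exact: map_mx_trig..].
by apply: eq_bigr => i _; rewrite !mxE.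
Qed.

(** * Location of the roots of a real quadratic *)

Lemma complex_quadratic_eq0 (R : realType) (a b x y : R) :
  (x +i* y)%C ^+ 2 - (x +i* y)%C * a%:C%C - b%:C%C = 0 <->
  x ^+ 2 - y ^+ 2 - a * x - b = 0 /\ y * (2 * x - a) = 0.
Proof.
rewrite expr2; simpc.
split=> [[re0 im0] | [re0 im0]].
  by split; [rewrite -re0 | rewrite -im0]; ring.
by congr (_ +i* _)%C; [rewrite -re0 | rewrite -im0]; ring.
Qed.

(** Both implications separate real roots from nonreal ones, whose real part is
    forced to be [a / 2] by the imaginary part of the equation. *)
Lemma quadratic_roots_Re_lt (R : realType) (a b alpha : R) :
  (forall z : R[i], z ^+ 2 - z * a%:C%C - b%:C%C = 0 ->
     complex.Re z < alpha) <->
  a / 2 < alpha /\ b < alpha ^+ 2 - alpha * a.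
Proof.
split=> [roots_lt | [a_lt b_lt] [x y] /complex_quadratic_eq0[re0 im0] /=].
  have [disc_ge0 | disc_lt0] := leP 0 (a ^+ 2 + 4 * b).
    set s := Num.sqrt (a ^+ 2 + 4 * b).
    have s_ge0 : 0 <= s by exact: sqrtr_ge0.
    have s2E : s ^+ 2 = a ^+ 2 + 4 * b by exact: sqr_sqrtr.
    have /= r_lt : complex.Re (((a + s) / 2) +i* 0)%C < alpha.
      apply/roots_lt/complex_quadratic_eq0; split; last by rewrite mul0r.
      have -> : b = (s ^+ 2 - a ^+ 2) / 4 by rewrite s2E; field.
      by field.
    split; first by lra.
    (* The quadratic at [alpha] is the product of two positive factors. *)
    have : 0 < (alpha - (a + s) / 2) * (alpha - (a - s) / 2).
      by apply: mulr_gt0; lra.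
    have -> : (alpha - (a + s) / 2) * (alpha - (a - s) / 2) =
        alpha ^+ 2 - alpha * a + (a ^+ 2 - s ^+ 2) / 4 by field.
    by rewrite s2E; lra.
  set s := Num.sqrt (- (a ^+ 2 + 4 * b)).
  have s2E : s ^+ 2 = - (a ^+ 2 + 4 * b) by apply: sqr_sqrtr; lra.
  have /= r_lt : complex.Re ((a / 2) +i* (s / 2))%C < alpha.
    apply/roots_lt/complex_quadratic_eq0; split; last by field.
    have -> : b = (- s ^+ 2 - a ^+ 2) / 4 by rewrite s2E; field.
    by field.
  split=> //.
  have := sqr_ge0 (alpha - a / 2).
  have -> : (alpha - a / 2) ^+ 2 = alpha ^+ 2 - alpha * a + a ^+ 2 / 4 by field.
  by lra.
rewrite ltNge; apply/negP => x_ge.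
move/eqP: im0; rewrite mulf_eq0 => /orP[/eqP y0 | /eqP xa]; last by lra.
(* The difference of the values of the quadratic at [x] and at [alpha]. *)
have : 0 <= (x - alpha) * (x + alpha - a) by apply: mulr_ge0; lra.
have -> : (x - alpha) * (x + alpha - a) =
    x ^+ 2 - a * x - (alpha ^+ 2 - alpha * a) by ring.
by move: re0; rewrite y0 expr0n /=; lra.
Qed.

(** * Stability of the block companion matrix *)

Theorem theorem7 (R : realType) (n : nat) (A B : 'M[R]_n) (alpha : R)
    (trigAB : (upper_triangular A /\ upper_triangular B) \/
              (lower_triangular A /\ lower_triangular B)) :
  Cminus_stable alpha (companion_block A B) <->
  (forall i : 'I_n, A i i / 2 < alpha /\ B i i < alpha ^+ 2 - alpha * A i i).
Proof.
split=> [stable i | diag z].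
  apply/quadratic_roots_Re_lt => z zi0; apply: (stable z).
  by apply/eigenvalue_companion_block_triangular => //; exists i.
move/(eigenvalue_companion_block_triangular z trigAB) => [i zi0].
exact: (quadratic_roots_Re_lt _ _ _).2 (diag i) z zi0.
Qed.
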